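(* Let $n\geq 4$ be an integer and let $\alpha,\beta>-1$ be real numbers. Let $x_{nn}(\alpha,\beta)$ denote the largest zero of the Jacobi polynomial $P_n^{(\alpha,\beta)}$. Then $$1-x_{nn}(\alpha,\beta)<\frac{4(\alpha+1)(\alpha+2)(\alpha+4)}{(5\alpha+11)\big[n(n+\alpha+\beta+1)+\frac{1}{3}(\alpha+1)(\beta+1)\big]}.$$ Moreover, if either $n\geq\max\{4,\alpha+\beta+3\}$ or $\beta\leq 4\alpha+7$, then $$1-x_{nn}(\alpha,\beta)<\frac{4(\alpha+1)(\alpha+2)(\alpha+4)}{(5\alpha+11)\big[n(n+\alpha+\beta+1)+\frac{1}{2}(\alpha+1)(\beta+1)\big]}.$$
   Context: For $\alpha,\beta>-1$, the Jacobi polynomial of degree $n$ is $$P_n^{(\alpha,\beta)}(x)=\frac{(\alpha+1)_n}{n!}\,{}_2F_1\Big(-n,n+\alpha+\beta+1;\alpha+1;\frac{1-x}{2}\Big)=\frac{(\alpha+1)_n}{n!}\sum_{k=0}^{n}\frac{(-n)_k\,(n+\alpha+\beta+1)_k}{k!\,(\alpha+1)_k}\Big(\frac{1-x}{2}\Big)^k,$$ where $(a)_0=1$ and $(a)_k=a(a+1)\cdots(a+k-1)$. These polynomials are orthogonal on $[-1,1]$ with respect to the weight $(1-x)^{\alpha}(1+x)^{\beta}$. The zeros of $P_n^{(\alpha,\beta)}$ are real, simple and lie in $(-1,1)$; they are denoted $x_{1n}(\alpha,\beta)<x_{2n}(\alpha,\beta)<\cdots<x_{nn}(\alpha,\beta)$.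 *)

(* Defs.v *)
From HB Require Import structures.
From mathcomp Require Import all_boot all_order all_algebra.
From mathcomp Require Import polyrcf.
From mathcomp Require Import reals.
Set Implicit Arguments.
Unset Strict Implicit.
Unset Printing Implicit Defensive.
Import Order.TTheory GRing.Theory Num.Theory.
Local Open Scope ring_scope.

Definition pochhammer (R : realType) (a : R) (k : nat) : R :=
  \prod_(i < k) (a + i%:R).

Definition jacobi (R : realType) (n : nat) (a b : R) : {poly R} :=
  (pochhammer (a + 1) n / n`!%:R) *:
    \sum_(k < n.+1)
      (pochhammer (- n%:R) k * pochhammer (n%:R + a + b + 1) k
       / (k`!%:R * pochhammer (a + 1) k)) *: (2^-1 *: (1 - 'X)) ^+ k.

(* [rootsR p] lists all the roots of [p != 0] in [R], without repetition and in
   increasing order, so its last item is the largest zero x_nn. The default 0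
   of [last] is never reached for n >= 1 and a, b > -1, where the list has n
   elements. *)
Definition jacobi_largest_zero (R : realType) (n : nat) (a b : R) : R :=
  last 0 (rootsR (jacobi n a b)).

(* Main.v *)
Require Import Defs.
From mathcomp Require Import all_boot all_order all_algebra.
From mathcomp Require Import reals complex polyrcf ring lra.
Import Order.TTheory GRing.Theory Num.Theory.
Local Open Scope ring_scope.

(** In the variable y = (1 - x) / 2 the Jacobi polynomial is a multiple of the
    hypergeometric polynomial F_n^{a,b}(y) with F_n^{a,b}(0) = 1. The raising
    relation
      (a+1) F_{n+1}^{a,b} = y(1-y) P' + ((a+1)(1-y) - (b+1) y) P,
      P = F_n^{a+1,b+1},
    says that a zero z of F_{n+1}^{a,b} with P(z) <> 0 satisfies
      sum_r 1 / (z - r) + (a+1) / z + (b+1) / (z - 1) = 0,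
    r running over the zeros of P. As in the Gauss-Lucas theorem, z is then a
    convex combination of 0, 1 and the r, so by induction on n all complex
    zeros of F_n^{a,b} lie in (0,1).

    Let p_k be the sum of the y_i^{-k} over the zeros y_i of F_n^{a,b}. The
    smallest zero y_1 satisfies y_1 <= p_3 / p_4. Newton's identities
    express p_3 and p_4 through the first coefficients, hence through
    A = a + 1, B = b + 1 and L = n(n+a+b+1), and the bound becomes a polynomial
    inequality in A, B, L. *)

(** * Location of zeros, after Gauss and Lucas *)

(** Each [q] is a pair (weight, pole). Conjugation turns [q.1 / (z - q.2)] into [c q * (z - q.2)]
    with [c q > 0], so [z] is a weighted mean of the poles. *)
Lemma root_partial_fractions_itv (C : numClosedFieldType) (l : seq (C * C))
    (z : C) :
  l != [::] -> (forall q, q \in l -> [/\ 0 < q.1, 0 <= q.2 <= 1 & z != q.2]) ->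
  \sum_(q <- l) q.1 / (z - q.2) = 0 -> 0 <= z <= 1.
Proof.
move=> l0 hl sum0.
pose c (q : C * C) := q.1 / `|z - q.2| ^+ 2.
have c_gt0 q : q \in l -> 0 < c q.
  by move=> /hl[w0 _ zq]; rewrite divr_gt0 // exprn_gt0 // normr_gt0 subr_eq0.
have W_gt0 : 0 < \sum_(q <- l) c q.
  case: l l0 c_gt0 {hl sum0} => // q l _ c_gt0.
  rewrite big_cons ltr_pwDl ?c_gt0 ?mem_head //.
  by rewrite big_seq sumr_ge0 // => r rl; rewrite ltW // c_gt0 // inE rl orbT.
have zW : z * \sum_(q <- l) c q = \sum_(q <- l) c q * q.2.
  apply/eqP; rewrite -subr_eq0 mulr_sumr -sumrB -conjC_eq0 rmorph_sum.
  rewrite -[X in _ == X]sum0 big_seq [X in _ == X]big_seq.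
  apply/eqP; apply: eq_bigr => q ql; have [w0 _ zq] := hl q ql.
  rewrite [z * _]mulrC -mulrBr rmorphM /= (CrealP (gtr0_real (c_gt0 q ql))).
  rewrite /c normCK -mulrA; congr (_ * _).
  by rewrite invfM -mulrA mulVf ?mulr1 // conjC_eq0 subr_eq0.
have W0 : \sum_(q <- l) c q != 0 by rewrite gt_eqF.
have -> : z = (\sum_(q <- l) c q * q.2) / \sum_(q <- l) c q.
  by rewrite -zW mulfK.
apply/andP; split.
  apply: divr_ge0; last exact: ltW.
  rewrite big_seq sumr_ge0 // => q ql; have [_ /andP[q0 _] _] := hl q ql.
  by rewrite mulr_ge0 // ltW // c_gt0.
rewrite ler_pdivrMr // mul1r big_seq [leRHS]big_seq ler_sum // => q ql.
have [_ /andP[_ q1] _] := hl q ql.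
by rewrite ler_piMr // ltW // c_gt0.
Qed.

Lemma horner_deriv_prod_XsubC (F : fieldType) (s : seq F) (z : F) :
  z \notin s ->
  ((\prod_(r <- s) ('X - r%:P))^`()).[z] =
  (\prod_(r <- s) ('X - r%:P)).[z] * \sum_(r <- s) (z - r)^-1.
Proof.
elim: s => [_|r s IHs]; first by rewrite !big_nil derivC hornerC mulr0.
rewrite inE negb_or => /andP[zr /IHs{}IHs].
rewrite !big_cons derivM derivXsubC !hornerE IHs.
by field; rewrite subr_eq0.
Qed.

Lemma roots_raising (C : numClosedFieldType) (p : {poly C}) (u v z : C) :
  0 < u -> 0 < v -> (forall r, root p r -> 0 < r < 1) ->
  root ('X * (1 - 'X) * p^`() + (u *: (1 - 'X) - v *: 'X) * p) z -> 0 < z < 1.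
Proof.
move=> u0 v0 hp.
have p0 : p != 0.
  by apply: contraPneq hp => -> /(_ 0); rewrite root0 ltxx => /(_ isT).
have [s ps] := closed_field_poly_normal p.
have lp0 : lead_coef p != 0 by rewrite lead_coef_eq0.
have rs r : root p r = (r \in s).
  by rewrite ps rootZ // root_prod_XsubC.
rewrite rootE !hornerE => /eqP hz.
have [zs|zs] := boolP (z \in s); first by apply: hp; rewrite rs.
have pz : p.[z] != 0 by rewrite -[_ == 0]/(root p z) rs.
(* At 0 and 1 the combination reduces to [u * p.[0]] and [- (v * p.[1])], both nonzero when p does
   not vanish there. *)
have z0 : z != 0.
  apply/eqP => zE; move: hz; rewrite {1 2 4 5}zE; apply/eqP.
  have -> : 0 * (1 - 0) * p^`().[z] + (u * (1 - 0) - v * 0) * p.[z] = u * p.[z].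
    by ring.
  by rewrite mulf_neq0 // gt_eqF.
have z1 : z != 1.
  apply/eqP => zE; move: hz; rewrite {1 2 4 5}zE; apply/eqP.
  have -> : 1 * (1 - 1) * p^`().[z] + (u * (1 - 1) - v * 1) * p.[z] =
    - (v * p.[z]).
    by ring.
  by rewrite oppr_eq0 mulf_neq0 // gt_eqF.
have dp : p^`().[z] = p.[z] * \sum_(r <- s) (z - r)^-1.
  by rewrite ps derivZ !hornerZ horner_deriv_prod_XsubC // mulrA.
(* These are the terms left after dividing [hz] by [z * (1 - z) * p.[z]]. *)
pose l := (u, 0) :: (v, 1) :: [seq (1 : C, r) | r <- s].
have : 0 <= z <= 1.
  apply: (@root_partial_fractions_itv _ l) => //.
    move=> q; rewrite !inE => /or3P[/eqP->|/eqP->|/mapP[r rs' ->]] /=.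
    - by rewrite lexx ler01.
    - by rewrite lexx ler01.
    - have /andP[r0 r1] : 0 < r < 1 by apply: hp; rewrite rs.
      by split=> //; [rewrite !ltW | apply: contraNneq zs => ->].
  rewrite !big_cons big_map /= subr0.
  under eq_bigr do rewrite mul1r.
  apply: (mulfI pz); rewrite mulr0.
  apply: (mulfI z0); rewrite mulr0.
  have z1' : 1 - z != 0 by rewrite subr_eq0 eq_sym.
  apply: (mulfI z1'); rewrite mulr0.
  rewrite -[RHS]hz dp; field.
  by rewrite z0 subr_eq0 z1.
by rewrite !le_eqVlt eq_sym (negPf z0) (negPf z1).
Qed.

(** * Newton's identities *)

(** The coefficient of index k in [q] is (-1)^k times the k-th elementary symmetric function of [s].
    Induction works because a new factor [1 - t *: 'X] only mixes neighbouring coefficients. *)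
Lemma newton_power_sums (F : comNzRingType) (s : seq F)
    (q := \prod_(t <- s) (1 - t *: 'X)) :
  [/\ q`_0 = 1,
      \sum_(t <- s) t ^+ 3 = - q`_1 ^+ 3 + 3 * q`_1 * q`_2 - 3 * q`_3 &
      \sum_(t <- s) t ^+ 4 =
        q`_1 ^+ 4 - 4 * q`_1 ^+ 2 * q`_2 + 2 * q`_2 ^+ 2 + 4 * q`_1 * q`_3
        - 4 * q`_4].
Proof.
rewrite {}/q; elim: s => [|t s].
  by rewrite !big_nil !coefC /=; split=> //; ring.
rewrite !big_cons; set q := \prod_(_ <- s) _ => -[q0 -> ->].
have qE k : ((1 - t *: 'X) * q)`_k =
    q`_k - t * (if k == 0%N then 0 else q`_k.-1).
  by rewrite mulrBl mul1r coefB -scalerAl coefZ coefXM.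
by rewrite !qE /= q0; split; ring.
Qed.

Section Jacobi.
Context (R : realType).
Implicit Types (a b c x A B L : R) (n k : nat).

(** * Polynomial inequalities in A, B, L *)

(* Numerators of p_3 / L and p_4 / L, see [hyp_power_sums]. *)
Definition p3_num L A B : R :=
  2 * L ^+ 2 + 2 * L * A ^+ 2 + 3 * L * A * B + A ^+ 4 + 2 * A ^+ 3 * B
    + A ^+ 3 + A ^+ 2 * B ^+ 2 + A ^+ 2 * B.
Definition p4_num L A B : R :=
  5 * L ^+ 3 * A + 6 * L ^+ 3 + 6 * L ^+ 2 * A ^+ 3
    + 10 * L ^+ 2 * A ^+ 2 * B + 8 * L ^+ 2 * A ^+ 2 + 12 * L ^+ 2 * A * B
  + 3 * L * A ^+ 5 + 9 * L * A ^+ 4 * B + 6 * L * A ^+ 4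
  + 6 * L * A ^+ 3 * B ^+ 2 + 15 * L * A ^+ 3 * B + 2 * L * A ^+ 3
  + 7 * L * A ^+ 2 * B ^+ 2 + 4 * L * A ^+ 2 * B + A ^+ 7 + 3 * A ^+ 6 * B
  + 4 * A ^+ 6 + 3 * A ^+ 5 * B ^+ 2
  + 9 * A ^+ 5 * B + 5 * A ^+ 5 + A ^+ 4 * B ^+ 3 + 6 * A ^+ 4 * B ^+ 2
  + 8 * A ^+ 4 * B + 2 * A ^+ 4 + A ^+ 3 * B ^+ 3
  + 3 * A ^+ 3 * B ^+ 2 + 2 * A ^+ 3 * B.

Local Ltac nonneg := repeat (first
  [ assumption | apply: addr_ge0 | apply: mulr_ge0 | apply: exprn_ge0
  | rewrite invr_ge0 | exact: ler0n | exact: ler01 ]).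

Lemma p4_num_gt0 L A B : 0 < L -> 0 < A -> 0 < B -> 0 < p4_num L A B.
Proof. by move=> *; rewrite /p4_num !(addr_gt0, mulr_gt0, exprn_gt0). Qed.

Lemma power_sum_ineq_third L A B : 0 < A -> 0 < B -> 1 <= L ->
  (5 * A + 6) * (L + 1 / 3 * A * B) * p3_num L A B < 2 * p4_num L A B.
Proof.
move=> A0 B0 hL; have M0 : 0 <= L - 1 by rewrite subr_ge0.
rewrite /p3_num /p4_num -subr_gt0; set X := (X in 0 < X).
(* All coefficients in A, B, L and L - 1 are positive; the term 4A^4 makes the inequality strict. *)
have -> : X = 4 * A ^+ 4 + A ^+ 2 * (2 * A * L * (L - 1) + 4 * L ^+ 2
  + 5 / 3 * B * L ^+ 2 +
    (A ^+ 3 + 14 / 3 * A ^+ 2 * B + A ^+ 2 + 2 * A * B ^+ 2 + 9 * A * B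
      + 2 * B ^+ 2 + 2 * B) * L) +
  2 * A * B * L ^+ 2 +
  A ^+ 3 * (2 * A ^+ 4 + 13 / 3 * A ^+ 3 * B + 8 * A ^+ 3
    + 8 / 3 * A ^+ 2 * B ^+ 2 + 43 / 3 * A ^+ 2 * B
    + 10 * A ^+ 2 + 1 / 3 * A * B ^+ 3 + 19 / 3 * A * B ^+ 2 + 14 * A * B
    + 4 * B ^+ 2 + 4 * B).
  by rewrite /X; field.
have L0 : 0 <= L by apply: le_trans hL.
have A4 : 0 < 4 * A ^+ 4 by rewrite mulr_gt0 ?exprn_gt0.
move/ltW: A0 => A0; move/ltW: B0 => B0.
by rewrite -!addrA ltr_pwDl //; nonneg.
Qed.

(** The threshold is the value of L = n(n+A+B-1) at n = A+B+1. The excess [M] over it serves as a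
    nonnegative variable. *)
Lemma power_sum_ineq_half_large L A B : 0 < A -> 0 < B ->
  2 * (A + B) * (A + B + 1) <= L ->
  (5 * A + 6) * (L + 1 / 2 * A * B) * p3_num L A B < 2 * p4_num L A B.
Proof.
rewrite -subr_ge0 => A0 B0; set M := L - _ => M0.
have LE : L = M + 2 * (A + B) * (A + B + 1) by rewrite /M; ring.
have A4 : 0 < 4 * A ^+ 4 by rewrite mulr_gt0 ?exprn_gt0.
move/ltW: A0 => A0; move/ltW: B0 => B0.
have L0 : 0 <= L by rewrite LE; nonneg.
rewrite /p3_num /p4_num -subr_gt0; set X := (X in 0 < X).
have -> : X = 4 * A ^+ 4 + A ^+ 2 * (
  (A + 2) * (L * (2 * M + 4 * A ^+ 2 + 7 / 2 * B ^+ 2 + 4 * B)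
             + 8 * A * B * (M + 2 * A ^+ 2 + 4 * A * B + 2 * A + 2 * B)
             + 31 / 2 * A * B ^+ 3)
  + L * (A ^+ 3 + 3 * A ^+ 2 * B + 5 * A ^+ 2 + 7 * A * B + 6 * A + 2 * B)
  + (2 * A ^+ 5 + 7 / 2 * A ^+ 4 * B + 8 * A ^+ 4 + A ^+ 3 * B ^+ 2
  + 25 / 2 * A ^+ 3 * B + 10 * A ^+ 3
     + 7 / 2 * A ^+ 2 * B ^+ 2 + 13 * A ^+ 2 * B + 3 * A * B ^+ 2 + 4 * A * B)).
  by rewrite /X LE; field.
by rewrite ltr_pwDl //; nonneg.
Qed.

(** The threshold is the value of L at n = 4, and B <= 4A + 4 is the condition b <= 4a + 7. *)
Lemma power_sum_ineq_half_small L A B : 0 < A -> 0 < B ->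
  4 * (A + B + 3) <= L -> B <= 4 * A + 4 ->
  (5 * A + 6) * (L + 1 / 2 * A * B) * p3_num L A B < 2 * p4_num L A B.
Proof.
rewrite -subr_ge0 -[B <= _]subr_ge0 => A0 B0; set M := L - _ => M0.
set D := _ - B => D0.
have LE : L = M + 4 * (A + B + 3) by rewrite /M; ring.
have A4 : 0 < 4 * A ^+ 4 by rewrite mulr_gt0 ?exprn_gt0.
move/ltW: A0 => A0; move/ltW: B0 => B0.
have L0 : 0 <= L by rewrite LE; nonneg.
rewrite /p3_num /p4_num -subr_gt0; set X := (X in 0 < X).
(* Every negative term carries a B^2, where one B is replaced by 4A + 4 - D. *)
have -> : X = 4 * A ^+ 4 + A ^+ 2 * ((2 * A + 4) * L * M
  + L * (8 * A ^+ 2 + 8 * A * B + 38 * A + 14 * B + 48 + A ^+ 3 + A ^+ 2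
  + (A + 2) * B * D / 2)
  + A * B * ((A + 1) * M + 4 * (A + 1) * (B + 3) + 5 / 2 * A ^+ 2 + 3 * A)
  + (A ^+ 3 + 5 / 2 * A ^+ 2 + A) * B * D + A ^+ 4 * D / 2
  + (A + 2) * A * B ^+ 2 * D / 2 + 6 * A ^+ 4 + 10 * A ^+ 3).
  by rewrite /X /D LE; field.
by rewrite ltr_pwDl //; nonneg.
Qed.

(** * The hypergeometric form of Jacobi polynomials *)

Lemma pochhammer0 x : pochhammer x 0 = 1.
Proof. exact: big_ord0. Qed.

Lemma pochhammerSr x k : pochhammer x k.+1 = pochhammer x k * (x + k%:R).
Proof. exact: big_ord_recr. Qed.

Lemma pochhammerSl x k : pochhammer x k.+1 = x * pochhammer (x + 1) k.
Proof.
rewrite [LHS]big_ord_recl addr0; congr (_ * _); apply: eq_bigr => i _.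
by rewrite -addrA -natr1 [1 + _]addrC.
Qed.

Lemma pochhammer_gt0 x k : 0 < x -> 0 < pochhammer x k.
Proof. by move=> x0; apply: prodr_gt0 => i _; rewrite ltr_pwDl. Qed.

Lemma pochhammer_oppn_eq0 n k : (n < k)%N -> pochhammer (- n%:R : R) k = 0.
Proof.
by move=> nk; rewrite /pochhammer (bigD1 (Ordinal nk)) //= addNr mul0r.
Qed.

Definition hyp_coef n a b k : R :=
  pochhammer (- n%:R) k * pochhammer (n%:R + a + b + 1) k
    / (k`!%:R * pochhammer (a + 1) k).

Definition hyp n a b : {poly R} := \poly_(k < n.+1) hyp_coef n a b k.

(** Beyond the degree, (-n)_k vanishes, so the closed form holds for every k. *)
Lemma coef_hyp n a b k : (hyp n a b)`_k = hyp_coef n a b k.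
Proof.
rewrite coef_poly; case: ltnP => // nk.
by rewrite /hyp_coef pochhammer_oppn_eq0 ?mul0r.
Qed.

Lemma hyp_coef0 n a b : hyp_coef n a b 0 = 1.
Proof. by rewrite /hyp_coef !pochhammer0 fact0 !mulr1 divr1. Qed.

Lemma hyp_neq0 n a b : hyp n a b != 0.
Proof.
apply/eqP => /(congr1 (fun p : {poly R} => p`_0)) /eqP.
by rewrite coef_hyp hyp_coef0 coef0 oner_eq0.
Qed.

Lemma jacobi_hyp n a b :
  jacobi n a b =
  (pochhammer (a + 1) n / n`!%:R) *: (hyp n a b \Po (2^-1 *: (1 - 'X))).
Proof.
rewrite /jacobi /hyp poly_def rmorph_sum /=; congr (_ *: _).
by apply: eq_bigr => k _; rewrite comp_polyZ rmorphXn /= comp_polyX.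
Qed.

Lemma hyp_raising n a b : -1 < a ->
  (a + 1) *: hyp n.+1 a b =
  'X * (1 - 'X) * (hyp n (a + 1) (b + 1))^`()
   + ((a + 1) *: (1 - 'X) - (b + 1) *: 'X) * hyp n (a + 1) (b + 1).
Proof.
move=> ha; set p := hyp n _ _.
have -> : 'X * (1 - 'X) * p^`() + ((a + 1) *: (1 - 'X) - (b + 1) *: 'X) * p =
  'X * p^`() + (a + 1) *: p - 'X * ('X * p^`() + (a + b + 2) *: p).
  by rewrite -!mul_polyC !rmorphD /=; ring.
apply/polyP => -[|k];
  rewrite !(coefD, coefN, coefZ, coefXM, coef_deriv) /= !coef_hyp.
  by rewrite !hyp_coef0; ring.
have -> : (if k == 0%N then 0
           else hyp_coef n (a + 1) (b + 1) k.-1.+1 *+ k.-1.+1) =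
    k%:R * hyp_coef n (a + 1) (b + 1) k.
  by case: k => [|k] /=; rewrite ?mul0r // mulr_natl.
rewrite -mulr_natl /hyp_coef.
(* Everything is reduced to the common symbols (-n)_k, (n+a+b+3)_k and (a+2)_k. *)
rewrite (pochhammerSl (- n.+1%:R)) (pochhammerSl (n.+1%:R + a + b + 1)).
rewrite (pochhammerSl (a + 1)) (pochhammerSr (a + 1 + 1)).
rewrite !(pochhammerSr (- n%:R)).
rewrite !(pochhammerSr (n%:R + (a + 1) + (b + 1) + 1)).
have -> : - n.+1%:R + 1 = - n%:R :> R by rewrite -natr1; ring.
have -> : n.+1%:R + a + b + 1 + 1 = n%:R + (a + 1) + (b + 1) + 1 :> R.
  by rewrite -natr1; ring.
rewrite factS natrM -!natr1.
have k0 : k`!%:R != 0 :> R by rewrite pnatr_eq0 -lt0n fact_gt0.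
have a0 : a + 1 != 0 by lra.
have p0 : pochhammer (a + 1 + 1) k != 0.
  by rewrite gt_eqF // pochhammer_gt0 //; lra.
have kge : 0 <= k%:R :> R by [].
field.
rewrite k0 p0 a0.
have : k%:R + 1 != 0 :> R by lra.
have : a + 1 + 1 + k%:R != 0 :> R by lra.
by move=> -> ->.
Qed.

(** * Real factorisation and power sums *)

Lemma hyp_complex_roots n a b (z : R[i]) : -1 < a -> -1 < b ->
  root (map_poly (real_complex R) (hyp n a b)) z -> 0 < z < 1.
Proof.
elim: n a b z => [|n IHn] a b z ha hb.
  rewrite /hyp poly_def big_ord1 hyp_coef0 scale1r expr0.
  by rewrite rmorph1 (negPf (root1 _)).
have a0 : 0 < a + 1 by lra.
have b0 : 0 < b + 1 by lra.
have aC : (a + 1)%:C%C != 0 by rewrite gt_eqF // ltcR.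
have map_raising (u v : R) (p : {poly R}) (f := map_poly (real_complex R)) :
    f ('X * (1 - 'X) * p^`() + (u *: (1 - 'X) - v *: 'X) * p) =
    'X * (1 - 'X) * (f p)^`() + (u%:C%C *: (1 - 'X) - v%:C%C *: 'X) * f p.
  rewrite /f rmorphD !rmorphM /= !rmorphB /= !map_polyZ rmorphB /= rmorph1.
  by rewrite map_polyX deriv_map.
rewrite -(rootZ _ _ aC) -map_polyZ hyp_raising // map_raising.
apply: roots_raising.
- by rewrite ltcR.
- by rewrite ltcR.
- by move=> r; apply: IHn; lra.
Qed.

(** The [ts] are the reciprocals of the zeros with multiplicity, as Newton's identities require. The
    zeros are real because [0 < z] in [R[i]] forces z to be real. *)
Lemma hyp_split n a b : -1 < a -> -1 < b ->
  exists2 ts : seq R, all (fun t => 0 < t) ts &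
    (forall t, t \in ts -> root (hyp n a b) t^-1) /\
    hyp n a b = \prod_(t <- ts) (1 - t *: 'X).
Proof.
move=> ha hb; set p := hyp n a b.
have hz := hyp_complex_roots n a b _ ha hb.
have [s ps] := closed_field_poly_normal (map_poly (real_complex R) p).
have lp0 : lead_coef (map_poly (real_complex R) p) != 0.
  by rewrite lead_coef_eq0 map_poly_eq0 hyp_neq0.
have rs z : root (map_poly (real_complex R) p) z = (z \in s).
  by rewrite ps rootZ // root_prod_XsubC.
have sE z : z \in s -> z = (complex.Re z)%:C%C.
  by rewrite -rs => /hz /andP[z0 _]; rewrite RRe_real // gtr0_real.
have s0 z : z \in s -> 0 < complex.Re z.
  by move=> zs; rewrite -ltcR -sE //; move: zs; rewrite -rs => /hz /andP[].
exists [seq (complex.Re z)^-1 | z <- s].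
  by apply/allP => _ /mapP[z zs ->]; rewrite invr_gt0 s0.
split=> [_ /mapP[z zs ->]|].
  by rewrite invrK -(fmorph_root (real_complex R)) /= -sE // rs.
have {}ps : p = lead_coef p *: \prod_(z <- s) ('X - (complex.Re z)%:P).
  apply: (map_poly_inj (real_complex R)).
  rewrite {1}ps map_polyZ lead_coef_map rmorph_prod; congr (_ *: _).
  rewrite big_seq [RHS]big_seq; apply: eq_bigr => z /sE zE.
  by rewrite rmorphB /= map_polyX map_polyC /= -zE.
have {}ps : p = (lead_coef p * \prod_(z <- s) - complex.Re z) *:
    \prod_(z <- s) (1 - (complex.Re z)^-1 *: 'X).
  rewrite {1}ps -scalerA; congr (_ *: _).
  rewrite -!mul_polyC rmorph_prod -big_split big_seq [RHS]big_seq /=.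
  apply: eq_bigr => z /s0 zp; rewrite mulrBr mulr1 -mul_polyC mulrA -rmorphM /=.
  by rewrite mulNr divff ?gt_eqF // rmorphN1 mulN1r opprK rmorphN addrC.
rewrite big_map {1}ps -[RHS]scale1r; congr (_ *: _).
(* Comparing constant terms shows that the remaining scalar is 1. *)
have : p`_0 = 1 by rewrite coef_hyp hyp_coef0.
rewrite {1}ps coefZ.
have -> : (\prod_(z <- s) (1 - (complex.Re z)^-1 *: 'X))`_0 = 1.
  have [] := newton_power_sums R [seq (complex.Re z)^-1 | z <- s].
  by rewrite big_map.
by rewrite mulr1.
Qed.

Lemma hyp_power_sums n a b (ts : seq R) (A := a + 1) (B := b + 1)
    (L := n%:R * (n%:R + a + b + 1)) :
  -1 < a -> hyp n a b = \prod_(t <- ts) (1 - t *: 'X) ->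
  \sum_(t <- ts) t ^+ 3 = L * p3_num L A B / (A ^+ 3 * (A + 1) * (A + 2)) /\
  \sum_(t <- ts) t ^+ 4 =
    L * p4_num L A B / (A ^+ 4 * (A + 1) ^+ 2 * (A + 2) * (A + 3)).
Proof.
move=> ha pE; have [_ -> ->] := newton_power_sums R ts.
rewrite -pE !coef_hyp.
have A0 : A != 0 by rewrite /A; lra.
have A1 : A + 1 != 0 by rewrite /A; lra.
have A2 : A + 2 != 0 by rewrite /A; lra.
have A3 : A + 3 != 0 by rewrite /A; lra.
(* n enters only through L, since (-n+j)(n+A+B-1+j) = -(L - j(A+B-1+j)). *)
have c1 : hyp_coef n a b 1 = - L / A.
  rewrite /hyp_coef !pochhammerSr !pochhammer0 ?factS fact0.
  by rewrite /L /A; field.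
have c2 : hyp_coef n a b 2 = L * (L - (A + B)) / (2 * A * (A + 1)).
  rewrite /hyp_coef !pochhammerSr !pochhammer0 ?factS fact0.
  by rewrite /L /A /B; field; rewrite -/A A0 A1.
have c3 : hyp_coef n a b 3 =
    - L * (L - (A + B)) * (L - 2 * (A + B + 1)) / (6 * A * (A + 1) * (A + 2)).
  rewrite /hyp_coef !pochhammerSr !pochhammer0 ?factS fact0.
  by rewrite /L /A /B; field; rewrite -/A A0 A1 A2.
have c4 : hyp_coef n a b 4 =
    L * (L - (A + B)) * (L - 2 * (A + B + 1)) * (L - 3 * (A + B + 2))
      / (24 * A * (A + 1) * (A + 2) * (A + 3)).
  rewrite /hyp_coef !pochhammerSr !pochhammer0 ?factS fact0.
  by rewrite /L /A /B; field; rewrite -/A A0 A1 A2 A3.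
rewrite c1 c2 c3 c4 /p3_num /p4_num; clear -A0 A1 A2 A3.
move: A B L A0 A1 A2 A3 => A B L A0 A1 A2 A3.
by split; field; rewrite ?A0 ?A1 ?A2 ?A3.
Qed.

(** * From power sums to the largest zero *)

Lemma jacobi_scale_neq0 n a : -1 < a -> pochhammer (a + 1) n / n`!%:R != 0.
Proof.
move=> ha; rewrite mulf_neq0 ?invr_eq0 ?pnatr_eq0 -?lt0n ?fact_gt0 //.
by rewrite gt_eqF // pochhammer_gt0 //; lra.
Qed.

Lemma root_jacobi_hyp n a b x : -1 < a ->
  root (jacobi n a b) x = root (hyp n a b) (2^-1 * (1 - x)).
Proof.
move=> ha; rewrite jacobi_hyp rootZ ?jacobi_scale_neq0 //.
by rewrite /root horner_comp !hornerE.
Qed.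

Lemma jacobi_neq0 n a b : -1 < a -> jacobi n a b != 0.
Proof.
move=> ha; rewrite jacobi_hyp scaler_eq0 negb_or jacobi_scale_neq0 //=.
rewrite comp_poly2_eq0 ?hyp_neq0 //.
by rewrite size_scale ?invr_eq0 ?pnatr_eq0 // -opprB size_polyN size_XsubC.
Qed.

Lemma root_le_jacobi_largest_zero n a b x : -1 < a ->
  root (jacobi n a b) x -> x <= jacobi_largest_zero n a b.
Proof.
move=> ha xr; rewrite /jacobi_largest_zero.
have: x \in rootsR (jacobi n a b).
  by rewrite -roots_on_rootsR ?jacobi_neq0 ?in_itv.
have: sorted <%R (rootsR (jacobi n a b)) by apply: sorted_roots.
rewrite lt_sorted_uniq_le => /andP[_].
move: (rootsR _) => l l_sorted xl.
rewrite -nth_last -{1}(nth_index 0 xl).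
apply: (sorted_leq_nth le_trans lexx) => //; rewrite ?inE ?index_mem //.
  by case: l xl {l_sorted}.
by move: xl; rewrite -index_mem; case: (size l).
Qed.

(** With y = (1 - x)/2 for the largest zero x, each reciprocal zero t satisfies y t <= 1, hence y
    t^4 <= t^3; summing gives y p_4 <= p_3. The numerator inequality then bounds p_3 / p_4. *)
Lemma jacobi_largest_zero_lt n a b c (A := a + 1) (B := b + 1)
    (L := n%:R * (n%:R + a + b + 1)) :
  -1 < a -> -1 < b -> 0 <= c -> 0 < L ->
  (5 * A + 6) * (L + c * A * B) * p3_num L A B < 2 * p4_num L A B ->
  1 - jacobi_largest_zero n a b <
    4 * A * (A + 1) * (A + 3) / ((5 * A + 6) * (L + c * A * B)).
Proof.
move=> ha hb c0 L0 N34.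
have A0 : 0 < A by rewrite /A; lra.
have B0 : 0 < B by rewrite /B; lra.
have [ts /allP ts0 [tsr pE]] := hyp_split n a b ha hb.
have [p3 p4] := hyp_power_sums n a b ts ha pE.
rewrite -/A -/B -/L in p3 p4.
set x := jacobi_largest_zero n a b.
have : 2^-1 * (1 - x) * \sum_(t <- ts) t ^+ 4 <= \sum_(t <- ts) t ^+ 3.
  rewrite mulr_sumr big_seq [leRHS]big_seq; apply: ler_sum => t tts.
  have t0 := ts0 t tts.
  have : 1 - 2 * t^-1 <= x.
    apply: root_le_jacobi_largest_zero => //; rewrite root_jacobi_hyp //.
    rewrite (_ : _ * _ = t^-1); [exact: tsr|by field; rewrite gt_eqF].
  move=> tx; have {}tx : 2^-1 * (1 - x) <= t^-1 by lra.
  rewrite [t ^+ 4]exprS mulrA ler_piMl ?exprn_ge0 ?(ltW t0) //.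
  by rewrite -ler_pdivlMr // mul1r.
have K0 : 0 < (5 * A + 6) * (L + c * A * B).
  by apply: mulr_gt0; [lra | rewrite ltr_pwDl // !mulr_ge0 // ltW].
have N40 := p4_num_gt0 L A B L0 A0 B0.
have A1 : 0 < A + 1 by rewrite ltr_wpDl // ltW.
have A2 : 0 < A + 2 by rewrite ltr_wpDl // ltW.
have A3 : 0 < A + 3 by rewrite ltr_wpDl // ltW.
set P := A ^+ 4 * (A + 1) ^+ 2 * (A + 2) * (A + 3) in p4.
have P0 : 0 < P by rewrite !mulr_gt0 ?exprn_gt0.
rewrite p3 p4 ltr_pdivlMr // => h.
(* The factor A(A+1)(A+3) is the quotient of the denominators of p_4 and p_3. *)
have {}h : (1 - x) * p4_num L A B <= 2 * A * (A + 1) * (A + 3) * p3_num L A B.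
  rewrite -(ler_pM2l (divr_gt0 L0 P0)).
  have -> : L / P * ((1 - x) * p4_num L A B) =
      2 * (2^-1 * (1 - x) * (L * p4_num L A B / P)).
    by field; rewrite !gt_eqF.
  have -> : L / P * (2 * A * (A + 1) * (A + 3) * p3_num L A B) =
      2 * (L * p3_num L A B / (A ^+ 3 * (A + 1) * (A + 2))).
    by rewrite /P; field; rewrite !gt_eqF.
  by rewrite ler_pM2l.
rewrite -(ltr_pM2r N40) mulrAC.
apply: le_lt_trans (ler_wpM2r (ltW K0) h) _.
have C0 : 0 < 2 * A * (A + 1) * (A + 3) by rewrite !mulr_gt0.
rewrite -[X in X < _]mulrA [X in _ * X < _]mulrC.
rewrite (_ : 4 * A * (A + 1) * (A + 3) * p4_num L A B =
  2 * A * (A + 1) * (A + 3) * (2 * p4_num L A B)); last by ring.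
by rewrite ltr_pM2l.
Qed.

End Jacobi.

(** * The two bounds *)

Theorem theorem1 (R : realType) (n : nat) (a b : R)
    (hn : (4 <= n)%N) (ha : -1 < a) (hb : -1 < b) :
  1 - jacobi_largest_zero n a b <
    4 * (a + 1) * (a + 2) * (a + 4) /
      ((5 * a + 11) *
       (n%:R * (n%:R + a + b + 1) + 1 / 3 * (a + 1) * (b + 1)))
  /\
  (Num.max 4 (a + b + 3) <= n%:R \/ b <= 4 * a + 7 ->
   1 - jacobi_largest_zero n a b <
     4 * (a + 1) * (a + 2) * (a + 4) /
       ((5 * a + 11) *
        (n%:R * (n%:R + a + b + 1) + 1 / 2 * (a + 1) * (b + 1)))).
Proof.
have n4 : 4 <= n%:R :> R by rewrite ler_nat.
have A0 : 0 < a + 1 by lra.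
have B0 : 0 < b + 1 by lra.
have -> : a + 2 = a + 1 + 1 by ring.
have -> : a + 4 = a + 1 + 3 by ring.
have -> : 5 * a + 11 = 5 * (a + 1) + 6 by ring.
set L := n%:R * (n%:R + a + b + 1).
have hL : 4 * (a + 1 + (b + 1) + 3) <= L by apply: ler_pM; lra.
have L0 : 0 < L by lra.
split.
  have c0 : 0 <= 1 / 3 :> R by lra.
  apply: jacobi_largest_zero_lt ha hb c0 L0 _.
  by apply: (power_sum_ineq_third R L) => //; lra.
move=> h; have c0 : 0 <= 1 / 2 :> R by lra.
apply: jacobi_largest_zero_lt ha hb c0 L0 _.
case: h => h; last by apply: (power_sum_ineq_half_small R L) => //; lra.
apply: (power_sum_ineq_half_large R L) => //.
have {}h : a + b + 3 <= n%:R by move: h; rewrite ge_max => /andP[].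
(* Factor by factor: n >= A+B+1 and n+a+b+1 >= 2(A+B), with A = a+1 and B = b+1. *)
by rewrite mulrC /L; apply: ler_pM; lra.
Qed.
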